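(* Let $\mathcal{E}$ be an exponential family of dimension $n$ defined over a finite set $\Omega=\{x_0,\dots,x_r\}$, with elements of the form $p(x;\theta)=\exp(C(x)+\langle F(x),\theta\rangle-\psi(\theta))$, $x\in\Omega$, $\theta\in\mathbb{R}^n$, where $C:\Omega\to\mathbb{R}$, $F=(F_1,\dots,F_n):\Omega\to\mathbb{R}^n$, $\psi:\mathbb{R}^n\to\mathbb{R}$, and the functions $1,F_1,\dots,F_n$ are linearly independent. Endow $\mathcal{E}$ and $\mathcal{P}_{r+1}^\times$ (the set of all strictly positive probability functions on $\Omega$) with their dually flat structures given by the Fisher metric and the exponential connection. Then the inclusion map $j:\mathcal{E}\hookrightarrow\mathcal{P}_{r+1}^\times$ is an affine isometric immersion.
   Context: A linear connection is flat if its torsion and curvature both vanish; $(M,h,\nabla)$ is a dually flat space if $\nabla$ and its dual connection $\nabla^*$ (defined by $Xh(Y,Z)=h(\nabla_XY,Z)+h(Y,\nabla^*_XZ)$) are flat. A coordinate system is $\nabla$-affine if $\nabla_{\partial/\partial x_i}\partial/\partial x_j=0$ for all $i,j$. A smooth map $f:M\to M'$ between dually flat spaces is affine if around every point of $M$ (and its image) there are $\nabla$-affine and $\nabla'$-affine coordinate systems in which $f$ is the restriction of an affine map $y\mapsto Ay+B$; it is isometric if $f^*h'=h$. For an exponential family as in the claim (probabilities with respect to counting measure, so $\sum_{x\in\Omega}p(x;\theta)=1$; $\langle\,,\rangle$ is the Euclidean pairing), the natural parameters $\theta=(\theta_1,\dots,\theta_n)$ are global coordinates. The Fisher metric $h_F$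 has components $\mathbb{E}_{p_\theta}(\partial_i\ln p_\theta\cdot\partial_j\ln p_\theta)$ and equals the Hessian of $\psi$ in the natural parameters; the exponential connection $\nabla^{(e)}$, with Christoffel symbols $\Gamma_{ij,k}=\mathbb{E}_{p_\theta}(\partial_i\partial_j\ln p_\theta\cdot\partial_k\ln p_\theta)$, is the flat connection for which the natural parameters are affine coordinates; $(\mathcal{E},h_F,\nabla^{(e)})$ is dually flat. $\mathcal{P}_{r+1}^\times$ is the exponential family of all $p:\Omega\to\mathbb{R}$ with $p>0$ and $\sum_{x\in\Omega}p(x)=1$; its natural parameters $\theta'=(\theta'_1,\dots,\theta'_r)\in\mathbb{R}^r$ are given by $p(x_i;\theta')=e^{\theta'_{i+1}-\psi'(\theta')}$ for $i=0,\dots,r-1$ and $p(x_r;\theta')=e^{-\psi'(\theta')}$, with $\psi'(\theta')=\ln(1+\sum_{k=1}^re^{\theta'_k})$. *)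

(* Defs.v *)
From HB Require Import structures.
From mathcomp Require Import all_boot all_order all_algebra.
From mathcomp Require Import mathcomp_extra boolp classical_sets functions.
From mathcomp Require Import reals topology normedtype derive sequences exp.

Set Implicit Arguments.
Unset Strict Implicit.
Unset Printing Implicit Defensive.

Import Order.TTheory GRing.Theory Num.Theory.
Import numFieldNormedType.Exports.

Local Open Scope classical_set_scope.
Local Open Scope ring_scope.

Section Calculus.
Variables (R : realType) (n : nat).
Implicit Types (i : 'I_n) (s : seq 'I_n) (f : 'rV[R]_n -> R).

Definition partial i f : 'rV[R]_n -> R :=
  fun t => 'D_(delta_mx ord0 i : 'rV[R]_n) f t.

Definition partials s f : 'rV[R]_n -> R := foldr partial f s.

(* C^oo on U: all iterated partial derivatives exist and are continuous. This
   is meant for open sets U, where partial derivatives only depend on f in U. *)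
Definition smooth_on (U : set 'rV[R]_n) f : Prop :=
  forall s t, U t ->
    {for t, continuous (partials s f)} /\
    forall i, derivable (partials s f) t (delta_mx ord0 i).

Definition smoothv_on m (U : set 'rV[R]_n) (g : 'rV[R]_n -> 'rV[R]_m) : Prop :=
  forall k, smooth_on U (fun t => g t ord0 k).

End Calculus.

Section Connections.
Variables (R : realType) (n : nat).
Implicit Types (X Y Z : 'rV[R]_n -> 'rV[R]_n) (f : 'rV[R]_n -> R).

(* A vector field on R^n is the function giving its components in the frame
   of the coordinate vector fields. *)
Definition smooth_vfield X : Prop := smoothv_on setT X.

Definition vderiv X f : 'rV[R]_n -> R :=
  fun t => \sum_i X t ord0 i * partial i f t.

Definition bracket X Y : 'rV[R]_n -> 'rV[R]_n := fun t =>
  \row_k (vderiv X (fun s => Y s ord0 k) t - vderiv Y (fun s => X s ord0 k) t).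

(* Christoffel symbols of a linear connection: G t i j k is the component
   Gamma_ij^k at t. *)
Definition connection := 'rV[R]_n -> 'I_n -> 'I_n -> 'I_n -> R.
Implicit Type G : connection.

Definition smooth_connection G : Prop :=
  forall i j k, smooth_on setT (fun t => G t i j k).

Definition nabla G X Y : 'rV[R]_n -> 'rV[R]_n := fun t =>
  \row_k (vderiv X (fun s => Y s ord0 k) t
          + \sum_i \sum_j G t i j k * X t ord0 i * Y t ord0 j).

Definition torsion G X Y : 'rV[R]_n -> 'rV[R]_n := fun t =>
  nabla G X Y t - nabla G Y X t - bracket X Y t.

Definition curvature G X Y Z : 'rV[R]_n -> 'rV[R]_n := fun t =>
  nabla G X (nabla G Y Z) t - nabla G Y (nabla G X Z) t
  - nabla G (bracket X Y) Z t.

Definition flat G : Prop :=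
  (forall X Y, smooth_vfield X -> smooth_vfield Y ->
     forall t, torsion G X Y t = 0) /\
  (forall X Y Z, smooth_vfield X -> smooth_vfield Y -> smooth_vfield Z ->
     forall t, curvature G X Y Z t = 0).

Definition dot (h : 'M[R]_n) (u v : 'rV[R]_n) : R :=
  (u *m h *m v^T) ord0 ord0.

Definition riemannian (h : 'rV[R]_n -> 'M[R]_n) : Prop :=
  [/\ forall i j, smooth_on setT (fun t => h t i j),
      forall t, (h t)^T = h t &
      forall t v, v != 0 -> 0 < dot (h t) v v].

Definition dual_connection (h : 'rV[R]_n -> 'M[R]_n) G G' : Prop :=
  forall X Y Z, smooth_vfield X -> smooth_vfield Y -> smooth_vfield Z ->
  forall t, vderiv X (fun s => dot (h s) (Y s) (Z s)) t =
    dot (h t) (nabla G X Y t) (Z t) + dot (h t) (Y t) (nabla G' X Z t).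

End Connections.

(* A manifold [carrier], contained in a type T, with global coordinates ranging
   over R^n, of which [param] is the inverse; the smooth structure is the one
   of these coordinates. The metric and the Christoffel symbols are given in
   these coordinates. *)
Record space (R : realType) (T : Type) (n : nat) := Space {
  carrier : set T;
  param : 'rV[R]_n -> T;
  metric : 'rV[R]_n -> 'M[R]_n;
  christoffel : connection R n }.

Definition dually_flat (R : realType) (T : Type) (n : nat) (M : space R T n) :=
  [/\ set_bij [set: 'rV[R]_n] (carrier M) (param M),
      riemannian (metric M),
      smooth_connection (christoffel M),
      flat (christoffel M) &
      exists G', [/\ smooth_connection G',
        dual_connection (metric M) (christoffel M) G' & flat G']].

(* Local coordinates, written in terms of the global ones: the coordinate map
   [lc_to] is a diffeomorphism from [lc_dom] onto [lc_img], inverse [lc_from]. *)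
Record local_coords (R : realType) (n : nat) := LocalCoords {
  lc_dom : set 'rV[R]_n;
  lc_img : set 'rV[R]_n;
  lc_to : 'rV[R]_n -> 'rV[R]_n;
  lc_from : 'rV[R]_n -> 'rV[R]_n }.

Section Coordinates.
Variables (R : realType) (n : nat).
Implicit Types (c : local_coords R n).

Definition coordinate_system c : Prop :=
  [/\ open (lc_dom c) /\ open (lc_img c),
      set_fun (lc_dom c) (lc_img c) (lc_to c),
      set_fun (lc_img c) (lc_dom c) (lc_from c),
      {in lc_dom c, cancel (lc_to c) (lc_from c)} /\
      {in lc_img c, cancel (lc_from c) (lc_to c)} &
      smoothv_on (lc_dom c) (lc_to c) /\ smoothv_on (lc_img c) (lc_from c)].

(* the coordinate vector field of c in direction j, defined on [lc_dom c] *)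
Definition coord_vfield c (j : 'I_n) : 'rV[R]_n -> 'rV[R]_n := fun t =>
  \row_k partial j (fun y => lc_from c y ord0 k) (lc_to c t).

Definition affine_coords (G : connection R n) c : Prop :=
  coordinate_system c /\
  forall i j t, lc_dom c t ->
    nabla G (coord_vfield c i) (coord_vfield c j) t = 0.

End Coordinates.

Section Maps.
Variables (R : realType) (T T' : Type) (n m : nat).
Variables (M : space R T n) (M' : space R T' m) (f : T -> T').

Definition chart (U : Type) (d : nat) (N : space R U d) (p : U) : 'rV[R]_d :=
  xget 0 [set t | param N t = p].

Definition local_rep : 'rV[R]_n -> 'rV[R]_m := fun t => chart M' (f (param M t)).

Definition smooth_map : Prop :=
  set_fun (carrier M) (carrier M') f /\ smoothv_on setT local_rep.

(* Coordinates are row vectors, so the matrix of the affine map acts on the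
   right. *)
Definition affine_map : Prop :=
  [/\ dually_flat M, dually_flat M', smooth_map &
      forall p, carrier M p ->
      exists (c : local_coords R n) (c' : local_coords R m)
             (A : 'M[R]_(n, m)) (B : 'rV[R]_m),
      [/\ affine_coords (christoffel M) c /\ lc_dom c (chart M p),
          affine_coords (christoffel M') c' /\ lc_dom c' (chart M' (f p)) &
          forall t, lc_dom c t -> lc_dom c' (local_rep t) /\
            lc_to c' (local_rep t) = lc_to c t *m A + B]].

Definition isometric : Prop := forall t u v,
  dot (metric M' (local_rep t)) ('d local_rep t u) ('d local_rep t v)
  = dot (metric M t) u v.

Definition immersion : Prop :=
  smooth_map /\ forall t, injective ('d local_rep t).

Definition affine_isometric_immersion : Prop :=
  [/\ affine_map, isometric & immersion].

End Maps.

Section Statistics.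
Variables (R : realType) (Omega : finType) (n : nat).

Section Model.
Variable p : 'rV[R]_n -> Omega -> R.

Definition score (i : 'I_n) (w : Omega) : 'rV[R]_n -> R :=
  partial i (fun t => ln (p t w)).

Definition fisher (t : 'rV[R]_n) : 'M[R]_n :=
  \matrix_(i, j) \sum_w p t w * (score i w t * score j w t).

Definition econn_lower (t : 'rV[R]_n) (i j k : 'I_n) : R :=
  \sum_w p t w * (partial i (score j w) t * score k w t).

(* Gamma_ij^k, obtained from the lower symbols Gamma_{ij,l} by raising l with
   the inverse of the Fisher metric *)
Definition econn : connection R n := fun t i j k =>
  \sum_l econn_lower t i j l * invmx (fisher t) l k.

Definition stat_space (E : set (Omega -> R)) : space R (Omega -> R) n :=
  Space E p fisher econn.

End Model.

Definition expfam (C : Omega -> R) (F : Omega -> 'rV[R]_n)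
    (psi : 'rV[R]_n -> R) (t : 'rV[R]_n) : Omega -> R :=
  fun w => expR (C w + \sum_i F w ord0 i * t ord0 i - psi t).

Definition expfam_space C F psi : space R (Omega -> R) n :=
  stat_space (expfam C F psi) (range (expfam C F psi)).

End Statistics.

Section Simplex.
Variables (R : realType) (Omega : finType) (r : nat) (x : 'I_r.+1 -> Omega).

Definition pos_prob : set (Omega -> R) :=
  [set p | (forall w, 0 < p w) /\ \sum_w p w = 1].

Definition simplex_psi (t : 'rV[R]_r) : R :=
  ln (1 + \sum_k expR (t ord0 k)).

(* With k counted from 0, the parameter t_k belongs to the point x_k for k < r,
   and no parameter belongs to x_r. *)
Definition simplex_F (w : Omega) : 'rV[R]_r :=
  \row_k (w == x (widen_ord (leqnSn r) k))%:R.

Definition simplex_param : 'rV[R]_r -> Omega -> R :=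
  expfam (fun=> 0) simplex_F simplex_psi.

Lemma simplex_param_widen (hx : injective x) t (k : 'I_r) :
  simplex_param t (x (widen_ord (leqnSn r) k)) = expR (t ord0 k - simplex_psi t).
Proof.
rewrite /simplex_param /expfam add0r (bigD1 k) //= mxE eqxx mul1r big1 ?addr0//.
move=> j jk; rewrite mxE (inj_eq hx) -val_eqE /= eq_sym (val_eqE j k).
by rewrite (negbTE jk) mul0r.
Qed.

Lemma simplex_param_last (hx : injective x) t :
  simplex_param t (x ord_max) = expR (- simplex_psi t).
Proof.
rewrite /simplex_param /expfam add0r big1 ?add0r// => j _.
by rewrite mxE (inj_eq hx) -val_eqE /= gtn_eqF ?mul0r.
Qed.

Definition simplex_space : space R (Omega -> R) r :=
  stat_space simplex_param pos_prob.

End Simplex.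

(* Main.v *)
Require Import Defs.
From HB Require Import structures.
From mathcomp Require Import all_boot all_order all_algebra.
From mathcomp Require Import mathcomp_extra boolp classical_sets functions.
From mathcomp Require Import reals topology normedtype derive sequences exp.
From mathcomp Require Import realfun ring lra.

Set Implicit Arguments.
Unset Strict Implicit.
Unset Printing Implicit Defensive.

Import Order.TTheory GRing.Theory Num.Theory.
Import numFieldNormedType.Exports.

Local Open Scope classical_set_scope.
Local Open Scope ring_scope.

(** In natural parameters an exponential family has
      ln p(w; t) = C(w) + <F(w), t> - psi(t),
    so all second derivatives of ln p are constant in w. Two consequences make
    the family dually flat ([expfam_dually_flat]). The score has mean zero, hence
    the exponential Christoffel symbols vanish in these parameters
    ([econn_expfam]); and the Fisher metric is the Hessian of psi
    ([fisher_hessian]), positive definite because 1, F_1, ..., F_n are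
    independent. For a Hessian metric h, the connection dual to D is
    Z |-> D_X (Z h) h^-1: it is the trivial connection read in the frame given
    by the rows of h^-1, so it has no curvature, and its torsion vanishes because
    the third derivatives of psi are symmetric ([hessian_dually_flat]).

    Flatness is asserted for arbitrary smooth vector fields, whose only known
    property is that iterated partial derivatives exist and are continuous. The
    curvature computation thus rests on the symmetry of second partial
    derivatives under that hypothesis ([second_derivatives_commute]), obtained
    from the mean value theorem applied to second differences.

    The simplex is the exponential family whose natural parameters are the log
    odds ln q(x_k) - ln q(x_r). The log odds of p(.; t) are affine functions of t
    ([log_odds_expfam]), so the inclusion is an affine map between global affine
    coordinates. The Fisher metric is the covariance of the directional scores,
    and a directional score is a statistic <F, v> centred so as to have mean
    zero. The inclusion carries <F, v> to itself up to an additive constant, which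
    the centring removes: the inclusion preserves directional scores
    ([dscore_inclusion]) and therefore the metric. It is an immersion because a
    vector v killed by its linear part makes <F, v> constant on Omega. *)

(** * Directional derivatives and the symmetry of second derivatives *)

Section DirectionalDerivative.
Variables (R : realType) (V : normedModType R).
Implicit Types (f : V -> R) (a v : V).

(** Reduces directional derivatives to derivatives of real functions of one
    real variable, for which the chain rule and the mean value theorem hold. *)
Lemma is_derive_line f a v (s df : R) :
  is_derive (s *: v + a) v f df <->
  is_derive s 1 (fun h : R => f (h *: v + a)) df.
Proof.
have e : (fun h : R => h^-1 *: ((f \o shift (s *: v + a)) (h *: v)
             - f (s *: v + a))) =
    (fun h : R => h^-1 *: (((fun h : R => f (h *: v + a)) \o shift s) (h *: 1)
             - f (s *: v + a))).
  by apply/funext => h /=; rewrite [h%:A]mulr1 scalerDl addrA.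
split=> -[dP dE]; split.
- by rewrite /derivable -e.
- by rewrite -dE /derive -e.
- by rewrite /derivable e.
- by rewrite -dE /derive e.
Qed.

Lemma is_derive_outer f a v (g : R -> R) (dg df : R) :
  is_derive (f a) 1 g dg -> is_derive a v f df ->
  is_derive a v (fun t => g (f t)) (dg * df).
Proof.
move=> dgP dfP; have e : a = (0 : R) *: v + a by rewrite scale0r add0r.
rewrite e; apply/is_derive_line.
apply: (@is_derive1_comp _ g (fun h : R => f (h *: v + a))); first by rewrite -e.
by apply/is_derive_line; rewrite -e.
Qed.

Lemma mean_value_line f df v a (e : R) : 0 < e ->
  (forall s, is_derive s v f (df s)) ->
  exists2 c, 0 <= c <= e & f (e *: v + a) - f a = df (c *: v + a) * e.
Proof.
move=> e0 dfP; pose g (h : R) := f (h *: v + a).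
have dg (h : R) : is_derive h 1 g (df (h *: v + a)).
  exact/is_derive_line.
have cg : {within `[0, e], continuous g}.
  by apply: derivable_within_continuous => h _; case: (dg h).
have [c cI E] := MVT e0 (fun h _ => dg h) cg.
exists c; first by move: cI; rewrite in_itv /= => /andP[/ltW -> /ltW ->].
by move: E; rewrite /g scale0r add0r subr0.
Qed.

(** The mean value theorem is used twice: on the increment of [f] in direction
    [v], as a function moving in direction [u], and then on [fu] in direction
    [v]. *)
Lemma second_difference f fu fuv u v t (e : R) : 0 < e ->
  (forall s, is_derive s u f (fu s)) -> (forall s, is_derive s v fu (fuv s)) ->
  exists c d, [/\ 0 <= c <= e, 0 <= d <= e &
    f (e *: u + e *: v + t) - f (e *: u + t) - (f (e *: v + t) - f t)
    = fuv (d *: v + (c *: u + t)) * e * e].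
Proof.
move=> e0 df ddf; pose g s := f (s + e *: v) - f s.
have dg s : is_derive s u g (fu (s + e *: v) - fu s).
  have df_shift : is_derive s u (fun s => f (s + e *: v)) (fu (s + e *: v)).
    have [/= dP dE] := df (s + e *: v).
    have E : (fun h : R => h^-1 *: ((f \o shift (s + e *: v)) (h *: u)
        - f (s + e *: v))) =
       (fun h : R => h^-1 *: (((fun s => f (s + e *: v)) \o shift s) (h *: u)
        - f (s + e *: v))).
      by apply/funext => h /=; rewrite addrA.
    by split; [rewrite /derivable -E|rewrite -dE /derive -E].
  exact: is_deriveB.
have [c cI E] := mean_value_line t e0 dg.
have [d dI E'] := mean_value_line (c *: u + t) e0 ddf.
exists c, d; split => //; rewrite -E'.
rewrite [e *: v + (c *: u + t)]addrC -E /g.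
have -> : e *: u + e *: v + t = e *: u + t + e *: v by rewrite addrAC.
by rewrite [t + e *: v]addrC.
Qed.

(** The intermediate points of the two expressions of a second difference are
    unrelated; all that is known is that both lie close to [t]. *)
Lemma eq_at_of_eq_nearby (P Q : V -> R) u v t :
  {for t, continuous P} -> {for t, continuous Q} ->
  (forall e : R, 0 < e -> exists c d c' d' : R,
    [/\ 0 <= c <= e, 0 <= d <= e, 0 <= c' <= e, 0 <= d' <= e &
     P (d *: v + (c *: u + t)) = Q (d' *: u + (c' *: v + t))]) ->
  P t = Q t.
Proof.
move=> cP cQ PQ; apply/eqP; rewrite -subr_eq0 -normr_le0.
apply/ler_addgt0Pr => eps eps0; rewrite add0r.
have eps20 : 0 < eps / 2 by rewrite divr_gt0.
have /cvgrPdist_lt/(_ _ eps20) H1 := cP.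
have /cvgrPdist_lt/(_ _ eps20) H2 := cQ.
have [del /= del0 B] := (nbhs_ballP _ _).1 (filterI H1 H2).
have n0 : 0 < `|u| + `|v| + 1 by rewrite ltr_wpDl ?addr_ge0.
(* The summand 1 keeps the denominator positive when u = v = 0. *)
pose e := del / (`|u| + `|v| + 1).
have e0 : 0 < e by rewrite divr_gt0.
have box c d w w' : 0 <= c <= e -> 0 <= d <= e -> `|w| + `|w'| = `|u| + `|v| ->
    ball t del (d *: w' + (c *: w + t)).
  move=> /andP[c0 ce] /andP[d0 de] ww.
  rewrite -ball_normE /= distrC addrA addrK.
  rewrite (le_lt_trans (ler_normD _ _))// !normrZ !ger0_norm//.
  have del_e : e * (`|u| + `|v| + 1) = del by rewrite divfK ?gt_eqF.
  rewrite -del_e -ww addrC 2!mulrDr mulr1.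
  apply: (le_lt_trans (y := e * `|w| + e * `|w'|)); last by rewrite ltrDl.
  by apply: lerD; apply: ler_wpM2r.
have [c [d [c' [d' [cI dI cI' dI' E]]]]] := PQ e e0.
have [/= A1 _] := B _ (box _ _ _ _ cI dI erefl).
have [/= _ A2] := B _ (box _ _ _ _ cI' dI' (addrC _ _)).
rewrite E in A1; rewrite distrC in A2.
rewrite -(subrKA (Q (d' *: u + (c' *: v + t)))).
by rewrite (le_trans (ler_normD _ _))// (splitr eps) lerD// ltW//.
Qed.

(** Clairaut's theorem, with no differentiability beyond the two directions: the
    second difference of [f] along [e *: u] and [e *: v] is symmetric in [u] and
    [v], and each order of differentiation gives it as [e * e] times a value of
    the corresponding mixed derivative. *)
Lemma second_derivatives_commute f fu fv fuv fvu u v t :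
  (forall s, is_derive s u f (fu s)) -> (forall s, is_derive s v f (fv s)) ->
  (forall s, is_derive s v fu (fuv s)) ->
  (forall s, is_derive s u fv (fvu s)) ->
  {for t, continuous fuv} -> {for t, continuous fvu} -> fuv t = fvu t.
Proof.
move=> du dv duv dvu cuv cvu.
apply: (eq_at_of_eq_nearby (u := u) (v := v) cuv cvu) => e e0.
have [c [d [cI dI E]]] := second_difference t e0 du duv.
have [c' [d' [cI' dI' E']]] := second_difference t e0 dv dvu.
exists c, d, c', d'; split => //.
have e_neq0 : e != 0 by rewrite gt_eqF.
apply: (mulIf e_neq0); apply: (mulIf e_neq0) => /=; rewrite -E -E'.
by rewrite [e *: u + e *: v]addrC; ring.
Qed.

End DirectionalDerivative.

(** * Smooth real functions *)

Section SmoothFunctions.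
Variables (R : realType) (n : nat).
Implicit Types (f g : 'rV[R]_n -> R) (i j k : 'I_n) (t : 'rV[R]_n).

Let e i : 'rV[R]_n := delta_mx ord0 i.

Lemma is_derive_coord i k t :
  is_derive t (e i) (fun t => t ord0 k) ((i == k)%:R : R).
Proof.
have [d dE] : is_derive t (e i) (fun t => t ord0 k) ('D_(e i) (fun t => t ord0 k) t).
  exact/derivableP/diff_derivable/differentiable_coord.
split => //; rewrite /derive; apply/lim_near_cst => //.
near=> h; rewrite /= !mxE eqxx /= addrK [k == i]eq_sym [_ *: _]mulrA mulVf ?mul1r//.
by near: h; exact: nbhs_dnbhs_neq.
Unshelve. all: by end_near. Qed.

(** Products and quotients of smooth functions do not differentiate to products
    and quotients but to sums of such terms, so an induction on iterated
    derivatives needs a class that is closed under all the operations at once: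
    the expressions built from smooth functions. *)
Inductive smooth_expr : ('rV[R]_n -> R) -> Prop :=
| SmoothBase f of smooth_on setT f : smooth_expr f
| SmoothCst (c : R) : smooth_expr (fun=> c)
| SmoothCoord k : smooth_expr (fun t => t ord0 k)
| SmoothAdd f g of smooth_expr f & smooth_expr g : smooth_expr (fun t => f t + g t)
| SmoothMul f g of smooth_expr f & smooth_expr g : smooth_expr (fun t => f t * g t)
| SmoothInv f of smooth_expr f & (forall t, f t != 0) :
    smooth_expr (fun t => (f t)^-1)
| SmoothExp f of smooth_expr f : smooth_expr (fun t => expR (f t))
| SmoothLn f of smooth_expr f & (forall t, 0 < f t) :
    smooth_expr (fun t => ln (f t)).

Lemma smooth_expr_derive f : smooth_expr f -> continuous f /\
  forall i, exists2 df, smooth_expr df & forall t, is_derive t (e i) f (df t).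
Proof.
elim=> {f} [f sf|c|k|f g _ [cf df] _ [cg dg]|f g sf [cf df] sg [cg dg]
           |f sf [cf df] f0|f sf [cf df]|f sf [cf df] f0].
- split=> [t|i]; first by have [] := sf [::] t.
  exists (partial i f) => [|t].
    by apply: SmoothBase => s t; have := sf (rcons s i) t;
      rewrite /partials -cats1 foldr_cat.
  by apply: derivableP; have [_] := sf [::] t I; apply.
- split=> [t|i]; first exact: cst_continuous.
  by exists (fun=> 0) => [|t]; [exact: SmoothCst|exact: is_derive_cst].
- split=> [|i]; first exact: coord_continuous.
  by exists (fun=> (i == k)%:R) => [|t];
    [exact: SmoothCst|exact: is_derive_coord].
- split=> [t|i]; first by apply: continuousD; [exact: cf|exact: cg].
  have [[df1 s1 d1] [dg1 s2 d2]] := (df i, dg i).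
  exists (fun t => df1 t + dg1 t) => [|t]; first exact: SmoothAdd.
  exact: is_deriveD.
- split=> [t|i]; first by apply: continuousM; [exact: cf|exact: cg].
  have [[df1 s1 d1] [dg1 s2 d2]] := (df i, dg i).
  exists (fun t => f t * dg1 t + g t * df1 t) => [|t].
    by apply: SmoothAdd; apply: SmoothMul.
  exact: is_deriveM.
- split=> [t|i]; first by apply: continuousV => //; exact: cf.
  have [df1 s1 d1] := df i.
  exists (fun t => (f t)^-1 * (f t)^-1 * (-1) * df1 t) => [|t].
    by do ![apply: SmoothMul => //]; [exact: SmoothInv|exact: SmoothInv|
      exact: SmoothCst].
  apply: is_derive_outer => //.
  apply: is_derive_eq; first exact: is_deriveV.
  by rewrite /GRing.scale/= mulr1 mulrN1 expr2 invfM.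
- split=> [t|i]; first by apply: continuous_comp; [exact: cf|exact: continuous_expR].
  have [df1 s1 d1] := df i.
  exists (fun t => expR (f t) * df1 t) => [|t].
    by apply: SmoothMul => //; exact: SmoothExp.
  exact: is_derive_outer.
- split=> [t|i].
    by apply: continuous_comp; [exact: cf|exact: continuous_ln].
  have [df1 s1 d1] := df i.
  exists (fun t => (f t)^-1 * df1 t) => [|t].
    by apply: SmoothMul => //; apply: SmoothInv => // t; rewrite gt_eqF.
  by apply: is_derive_outer => //; exact: is_derive1_ln.
Qed.

(** Partial derivatives of an expression are expressions, and expressions are
    continuous and derivable; hence all iterated partial derivatives exist and are
    continuous. The closure properties below follow. *)
Lemma smooth_exprP f : smooth_on setT f <-> smooth_expr f.
Proof.
split=> [|sf s t _]; first exact: SmoothBase.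
suff sps : smooth_expr (partials s f).
  have [c d] := smooth_expr_derive sps.
  by split=> [|i]; [exact: c|have [df _ /(_ t)[]] := d i].
elim: s => //= i s /smooth_expr_derive[_ /(_ i)[df sdf dfP]].
suff -> : partial i (partials s f) = df by [].
by apply/funext => u; have [_] := dfP u.
Qed.

Lemma smooth_cst (c : R) : smooth_on [set: 'rV[R]_n] (fun=> c).
Proof. exact/smooth_exprP/SmoothCst. Qed.

Lemma smooth_coord k : smooth_on [set: 'rV[R]_n] (fun t => t ord0 k).
Proof. exact/smooth_exprP/SmoothCoord. Qed.

Lemma smoothD f g : smooth_on setT f -> smooth_on setT g ->
  smooth_on setT (fun t => f t + g t).
Proof.
by move=> /smooth_exprP sf /smooth_exprP sg; apply/smooth_exprP/SmoothAdd.
Qed.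

Lemma smoothM f g : smooth_on setT f -> smooth_on setT g ->
  smooth_on setT (fun t => f t * g t).
Proof.
by move=> /smooth_exprP sf /smooth_exprP sg; apply/smooth_exprP/SmoothMul.
Qed.

Lemma smoothB f g : smooth_on setT f -> smooth_on setT g ->
  smooth_on setT (fun t => f t - g t).
Proof.
move=> sf sg; rewrite (_ : (fun _ => _) = fun t => f t + -1 * g t).
  exact: smoothD sf (smoothM (smooth_cst _) sg).
by apply/funext => t; rewrite mulN1r.
Qed.

Lemma smoothV f : smooth_on setT f -> (forall t, f t != 0) ->
  smooth_on setT (fun t => (f t)^-1).
Proof. by move=> /smooth_exprP sf f0; apply/smooth_exprP/SmoothInv. Qed.

Lemma smooth_expR f : smooth_on setT f -> smooth_on setT (fun t => expR (f t)).
Proof. by move=> /smooth_exprP sf; apply/smooth_exprP/SmoothExp. Qed.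

Lemma smooth_ln f : smooth_on setT f -> (forall t, 0 < f t) ->
  smooth_on setT (fun t => ln (f t)).
Proof. by move=> /smooth_exprP sf f0; apply/smooth_exprP/SmoothLn. Qed.

Lemma smooth_sum (I : Type) (r : seq I) (P : pred I) (F : I -> 'rV[R]_n -> R) :
  (forall a, smooth_on setT (F a)) ->
  smooth_on setT (fun t => \sum_(a <- r | P a) F a t).
Proof.
move=> sF; elim: r => [|a r IH].
  by under eq_fun do rewrite big_nil; exact: smooth_cst.
under eq_fun do rewrite big_cons.
by case: (P a); [exact: smoothD (sF a) IH|exact: IH].
Qed.

Lemma smooth_prod (I : Type) (r : seq I) (P : pred I) (F : I -> 'rV[R]_n -> R) :
  (forall a, smooth_on setT (F a)) ->
  smooth_on setT (fun t => \prod_(a <- r | P a) F a t).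
Proof.
move=> sF; elim: r => [|a r IH].
  by under eq_fun do rewrite big_nil; exact: smooth_cst.
under eq_fun do rewrite big_cons.
by case: (P a); [exact: smoothM (sF a) IH|exact: IH].
Qed.

Lemma smooth_is_derive f i t :
  smooth_on setT f -> is_derive t (e i) f (partial i f t).
Proof. by move=> sf; apply/derivableP; have [_] := sf [::] t I; apply. Qed.

Lemma smooth_continuous f : smooth_on setT f -> continuous f.
Proof. by move=> sf t; have [] := sf [::] t I. Qed.

Lemma smooth_partial i f : smooth_on setT f -> smooth_on setT (partial i f).
Proof.
by move=> sf s t; have := sf (rcons s i) t; rewrite /partials -cats1 foldr_cat.
Qed.

Lemma partial_cst i (c : R) t : partial i (fun=> c) t = 0.
Proof. exact: derive_cst. Qed.

Lemma partial_coord i k t : partial i (fun t => t ord0 k) t = (i == k)%:R.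
Proof. by have [_] := is_derive_coord i k t. Qed.

Lemma partialD i f g t : smooth_on setT f -> smooth_on setT g ->
  partial i (fun t => f t + g t) t = partial i f t + partial i g t.
Proof.
move=> /(@smooth_is_derive _ i t) df /(@smooth_is_derive _ i t) dg.
by have [_] := is_deriveD df dg.
Qed.

Lemma partialB i f g t : smooth_on setT f -> smooth_on setT g ->
  partial i (fun t => f t - g t) t = partial i f t - partial i g t.
Proof.
move=> /(@smooth_is_derive _ i t) df /(@smooth_is_derive _ i t) dg.
by have [_] := is_deriveB df dg.
Qed.

Lemma partialM i f g t : smooth_on setT f -> smooth_on setT g ->
  partial i (fun t => f t * g t) t = f t * partial i g t + partial i f t * g t.
Proof.
move=> /(@smooth_is_derive _ i t) df /(@smooth_is_derive _ i t) dg.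
by rewrite [_ * g t]mulrC; have [_] := is_deriveM df dg.
Qed.

Lemma partial_expR i f t : smooth_on setT f ->
  partial i (fun t => expR (f t)) t = expR (f t) * partial i f t.
Proof.
move=> /(@smooth_is_derive _ i t) df.
by have [_] := is_derive_outer (is_derive_expR (f t)) df.
Qed.

Lemma partial_sum (I : Type) (r : seq I) (P : pred I) (F : I -> 'rV[R]_n -> R) i t :
  (forall a, smooth_on setT (F a)) ->
  partial i (fun t => \sum_(a <- r | P a) F a t) t =
  \sum_(a <- r | P a) partial i (F a) t.
Proof.
move=> sF; elim: r => [|a r IH].
  by under eq_fun do rewrite big_nil; rewrite big_nil partial_cst.
under eq_fun do rewrite big_cons; rewrite big_cons.
case: (P a); last exact: IH.
by rewrite (partialD _ _ (sF a) (smooth_sum _ _ sF)) IH.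
Qed.

Lemma partialC i j f t : smooth_on setT f ->
  partial i (partial j f) t = partial j (partial i f) t.
Proof.
move=> sf; have sp k : smooth_on setT (partial k f) := smooth_partial k sf.
apply: (second_derivatives_commute (f := f) (fu := partial j f)
  (fv := partial i f) (u := e j) (v := e i)).
- by move=> s; exact: smooth_is_derive j s sf.
- by move=> s; exact: smooth_is_derive i s sf.
- by move=> s; exact: smooth_is_derive i s (sp j).
- by move=> s; exact: smooth_is_derive j s (sp i).
- exact: smooth_continuous (smooth_partial i (sp j)) t.
- exact: smooth_continuous (smooth_partial j (sp i)) t.
Qed.

End SmoothFunctions.

(** * Matrix fields and their derivatives along vector fields *)

Section MatrixFields.
Variables (R : realType) (n : nat).
Implicit Types (X Y : 'rV[R]_n -> 'rV[R]_n) (t : 'rV[R]_n).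

Definition smooth_mx p q (A : 'rV[R]_n -> 'M[R]_(p, q)) : Prop :=
  forall a b, smooth_on setT (fun t => A t a b).

(** The derivative of a matrix field along [X], entry by entry. For a row vector
    field this is the covariant derivative of the trivial connection; stated for
    matrices of any size, one Leibniz rule covers the metric, vector fields and
    their products. *)
Definition mxderiv p q X (A : 'rV[R]_n -> 'M[R]_(p, q)) : 'rV[R]_n -> 'M_(p, q) :=
  fun t => \matrix_(a, b) vderiv X (fun s => A s a b) t.

Lemma smooth_vfield_mx X : smooth_vfield X <-> smooth_mx X.
Proof.
by split=> [sX a b|sX k]; [rewrite [a]ord1; exact: sX|exact: sX].
Qed.

Lemma smooth_mxM p q r (A : 'rV[R]_n -> 'M[R]_(p, q)) (B : _ -> 'M_(q, r)) :
  smooth_mx A -> smooth_mx B -> smooth_mx (fun t => A t *m B t).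
Proof.
move=> sA sB a b; under eq_fun do rewrite mxE.
by apply: smooth_sum => c; apply: smoothM.
Qed.

Lemma smooth_det p (A : 'rV[R]_n -> 'M[R]_p) :
  smooth_mx A -> smooth_on setT (fun t => \det (A t)).
Proof.
move=> sA; apply: smooth_sum => s; apply: smoothM; first exact: smooth_cst.
by apply: smooth_prod => a; exact: sA.
Qed.

Lemma smooth_invmx p (A : 'rV[R]_n -> 'M[R]_p) :
  smooth_mx A -> (forall t, A t \in unitmx) -> smooth_mx (fun t => invmx (A t)).
Proof.
move=> sA uA a b.
rewrite (_ : (fun _ => _) = fun t => (\det (A t))^-1 * cofactor (A t) b a).
  apply: smoothM.
    apply: smoothV => [|t]; first exact: smooth_det.
    by have := uA t; rewrite unitmxE unitfE.
  apply: smoothM; first exact: smooth_cst.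
  apply: smooth_det => c d.
  rewrite (_ : (fun _ => _) = fun t => A t (lift b c) (lift a d)).
    exact: sA.
  by apply/funext => t; rewrite !mxE.
by apply/funext => t; rewrite /invmx uA !mxE.
Qed.

Lemma smooth_vderiv X f : smooth_vfield X -> smooth_on setT f ->
  smooth_on setT (vderiv X f).
Proof.
by move=> sX sf; apply: smooth_sum => i; exact: smoothM (sX i) (smooth_partial i sf).
Qed.

Lemma smooth_mxderiv p q X (A : 'rV[R]_n -> 'M[R]_(p, q)) :
  smooth_vfield X -> smooth_mx A -> smooth_mx (mxderiv X A).
Proof.
move=> sX sA a b; rewrite (_ : (fun _ => _) = vderiv X (fun s => A s a b)).
  exact: smooth_vderiv.
by apply/funext => t; rewrite mxE.
Qed.

Lemma mxderivM p q r X (A : 'rV[R]_n -> 'M[R]_(p, q)) (B : _ -> 'M_(q, r)) t :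
  smooth_mx A -> smooth_mx B ->
  mxderiv X (fun s => A s *m B s) t
  = A t *m mxderiv X B t + mxderiv X A t *m B t.
Proof.
move=> sA sB; apply/matrixP => a b.
transitivity (\sum_i \sum_c X t ord0 i * (A t a c * partial i (fun s => B s c b) t
    + partial i (fun s => A s a c) t * B t c b)).
  rewrite mxE; apply: eq_bigr => i _; rewrite -mulr_sumr; congr (_ * _).
  under [X in partial i X]eq_fun do rewrite mxE.
  rewrite partial_sum => [|c]; last exact: smoothM.
  by apply: eq_bigr => c _; rewrite partialM.
rewrite exchange_big !mxE -big_split /=; apply: eq_bigr => c _.
rewrite !mxE mulr_sumr mulr_suml -big_split; apply: eq_bigr => i _ /=; ring.
Qed.

(** Both composites expand into first-order terms, which form the bracket, and
    second-order terms, which cancel by symmetry of second derivatives. *)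
Lemma vderiv_bracket X Y f t : smooth_vfield X -> smooth_vfield Y ->
  smooth_on setT f ->
  vderiv X (vderiv Y f) t - vderiv Y (vderiv X f) t = vderiv (bracket X Y) f t.
Proof.
move=> sX sY sf.
have expand X' Y' : smooth_vfield X' -> smooth_vfield Y' ->
    vderiv X' (vderiv Y' f) t =
    \sum_j vderiv X' (fun s => Y' s ord0 j) t * partial j f t +
    \sum_i \sum_j X' t ord0 i * Y' t ord0 j * partial i (partial j f) t.
  move=> sX' sY'; under eq_bigr do rewrite mulr_suml.
  rewrite exchange_big -big_split /=; apply: eq_bigr => i _.
  rewrite partial_sum => [|j]; last exact: smoothM (sY' j) (smooth_partial j sf).
  rewrite mulr_sumr -big_split /=; apply: eq_bigr => j _.
  rewrite (partialM _ _ (sY' j) (smooth_partial j sf)).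
  by rewrite mulrDr addrC !mulrA.
rewrite !expand// addrAC opprD addrA.
have -> : \sum_i \sum_j Y t ord0 i * X t ord0 j * partial i (partial j f) t =
          \sum_i \sum_j X t ord0 i * Y t ord0 j * partial i (partial j f) t.
  rewrite exchange_big /=; apply: eq_bigr => i _; apply: eq_bigr => j _.
  by rewrite partialC// [Y t _ _ * _]mulrC.
rewrite subrK -sumrB; apply: eq_bigr => j _.
by rewrite mxE mulrBl.
Qed.

Lemma mxderiv_bracket p q X Y (A : 'rV[R]_n -> 'M[R]_(p, q)) t :
  smooth_vfield X -> smooth_vfield Y -> smooth_mx A ->
  mxderiv X (mxderiv Y A) t - mxderiv Y (mxderiv X A) t
  = mxderiv (bracket X Y) A t.
Proof.
move=> sX sY sA; apply/matrixP => a b; rewrite !mxE.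
rewrite -(vderiv_bracket _ sX sY (sA a b)).
by congr (vderiv X _ t - vderiv Y _ t); apply/funext => s; rewrite mxE.
Qed.

End MatrixFields.

(** * Connections with a parallel frame *)

Section FrameConnection.
Variables (R : realType) (n : nat).
Implicit Types (X Y Z : 'rV[R]_n -> 'rV[R]_n) (t : 'rV[R]_n).
Implicit Types (h : 'rV[R]_n -> 'M[R]_n).

(** The connection for which the rows of [h^-1] form a parallel frame: the matrix
    of its form in direction i is [(d_i h) h^-1]. A constant [h] gives the trivial
    connection, so both connections of a Hessian structure have this form. *)
Definition frame_connection h : connection R n := fun t i j k =>
  \sum_l partial i (fun s => h s j l) t * invmx (h t) l k.

Lemma frame_connection_cst (h0 : 'M[R]_n) :
  frame_connection (fun=> h0) = fun _ _ _ _ => 0.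
Proof.
apply/funext => t; apply/funext => i; apply/funext => j; apply/funext => k.
by apply: big1 => l _; rewrite partial_cst mul0r.
Qed.

Lemma smooth_frame_connection h : smooth_mx h -> (forall t, h t \in unitmx) ->
  smooth_connection (frame_connection h).
Proof.
move=> sh uh i j k; apply: smooth_sum => l; apply: smoothM.
  exact: smooth_partial.
exact: smooth_invmx.
Qed.

Lemma nabla_frame_connectionE h X Z :
  nabla (frame_connection h) X Z =
  fun t => mxderiv X Z t + Z t *m mxderiv X h t *m invmx (h t).
Proof.
apply/funext => t; apply/rowP => k; rewrite !mxE; congr (_ + _).
transitivity (\sum_i \sum_j \sum_l
   X t ord0 i * Z t ord0 j * partial i (fun s => h s j l) t * invmx (h t) l k).
  apply: eq_bigr => i _; apply: eq_bigr => j _.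
  by rewrite !mulr_suml; apply: eq_bigr => l _; ring.
under eq_bigr do rewrite exchange_big.
rewrite exchange_big; apply: eq_bigr => l _; rewrite !mxE mulr_suml exchange_big.
apply: eq_bigr => j _ /=; rewrite mxE mulr_sumr mulr_suml.
by apply: eq_bigr => i _; ring.
Qed.

(** [Z h] is the vector of components of [Z] in the parallel frame, and it is
    these components that the connection differentiates. *)
Lemma nabla_frame_connection h X Z : smooth_mx h -> (forall t, h t \in unitmx) ->
  smooth_vfield Z ->
  nabla (frame_connection h) X Z =
  fun t => mxderiv X (fun s => Z s *m h s) t *m invmx (h t).
Proof.
move=> sh uh /smooth_vfield_mx sZ; rewrite nabla_frame_connectionE.
by apply/funext => t; rewrite mxderivM// mulmxDl mulmxK// addrC.
Qed.

Lemma mxderiv_exchange h X Y t :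
  (forall i j k, partial i (fun s => h s j k) t = partial j (fun s => h s i k) t) ->
  Y t *m mxderiv X h t = X t *m mxderiv Y h t.
Proof.
move=> hC; apply/rowP => k; rewrite !mxE.
under eq_bigr do rewrite mxE mulr_sumr.
under [RHS]eq_bigr do rewrite mxE mulr_sumr.
rewrite exchange_big /=; apply: eq_bigr => i _; apply: eq_bigr => j _.
by rewrite hC mulrCA.
Qed.

(** In the components [Z h] the covariant derivative is a plain derivative, so
    the curvature reduces to the defining property of the bracket. The torsion is
    the part of [(d_i h_jk)] antisymmetric in i and j. *)
Lemma flat_frame_connection h : smooth_mx h -> (forall t, h t \in unitmx) ->
  (forall t i j k,
    partial i (fun s => h s j k) t = partial j (fun s => h s i k) t) ->
  flat (frame_connection h).
Proof.
move=> sh uh hC; split=> [X Y sX sY t|X Y Z sX sY sZ t].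
  rewrite /torsion !nabla_frame_connectionE (mxderiv_exchange X Y (hC t)).
  rewrite opprD addrACA subrr addr0; apply/rowP => k.
  by rewrite !mxE subrr.
have sZh : smooth_mx (fun s => Z s *m h s).
  by apply: smooth_mxM => //; exact/smooth_vfield_mx.
have snabla Y' : smooth_vfield Y' -> smooth_vfield (nabla (frame_connection h) Y' Z).
  move=> sY'; rewrite (nabla_frame_connection Y' sh uh sZ).
  apply/smooth_vfield_mx/smooth_mxM; last exact: smooth_invmx.
  exact: smooth_mxderiv sY' sZh.
have nablaK Y' : smooth_vfield Y' ->
    (fun s => nabla (frame_connection h) Y' Z s *m h s) =
    mxderiv Y' (fun s => Z s *m h s).
  move=> sY'; rewrite (nabla_frame_connection Y' sh uh sZ).
  by apply/funext => s; rewrite mulmxKV.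
rewrite /curvature (nabla_frame_connection X sh uh (snabla Y sY)).
rewrite (nabla_frame_connection Y sh uh (snabla X sX)) !nablaK//.
rewrite (nabla_frame_connection (bracket X Y) sh uh sZ).
by rewrite -mulmxBl mxderiv_bracket// subrr.
Qed.

(** Leibniz on [Y h Z^T]: the terms [Y (D_X h) Z^T + Y h (D_X Z)^T] are
    [Y h (D_X Z + Z (D_X h) h^-1)^T] by symmetry of [h]. *)
Lemma dual_frame_connection h : smooth_mx h -> (forall t, h t \in unitmx) ->
  (forall t, (h t)^T = h t) ->
  dual_connection h (fun _ _ _ _ => 0) (frame_connection h).
Proof.
move=> sh uh hT X Y Z sX /smooth_vfield_mx sY /smooth_vfield_mx sZ t.
rewrite -(frame_connection_cst 1%:M) !nabla_frame_connectionE.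
have -> : mxderiv X (fun=> 1%:M : 'M[R]_n) t = 0.
  by apply/matrixP => a b; rewrite !mxE; apply: big1 => i _;
    rewrite partial_cst mulr0.
have -> : vderiv X (fun s => dot (h s) (Y s) (Z s)) t =
    mxderiv X (fun s => Y s *m h s *m (Z s)^T) t ord0 ord0 by rewrite mxE.
have mxderiv_tr p q (A : 'rV[R]_n -> 'M[R]_(p, q)) :
    mxderiv X (fun s => (A s)^T) t = (mxderiv X A t)^T.
  apply/matrixP => a b; rewrite !mxE; congr (vderiv X _ t).
  by apply/funext => s; rewrite mxE.
have dhT : (mxderiv X h t)^T = mxderiv X h t.
  by rewrite -mxderiv_tr; under eq_fun do rewrite hT.
have sZT : smooth_mx (fun s => (Z s)^T).
  by move=> a b; under eq_fun do rewrite mxE; exact: sZ.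
rewrite (mxderivM _ _ (smooth_mxM sY sh) sZT) (mxderivM _ _ sY sh) !mxderiv_tr mulmx0 mul0mx addr0 /dot.
rewrite linearD /= !trmx_mul trmx_inv hT dhT.
rewrite mulmxDr mulmxDl !mulmxA mulmxK// !mxE; ring.
Qed.

End FrameConnection.

(** * Hessian metrics *)

Lemma riemannian_unitmx (R : realType) n (h : 'rV[R]_n -> 'M[R]_n) t :
  riemannian h -> h t \in unitmx.
Proof.
case=> _ _ h0; rewrite -row_free_unit -kermx_eq0; apply/rowV0P => v /sub_kermxP vh.
apply/eqP; apply: contraT => /(h0 t).
by rewrite /dot vh mul0mx mxE ltxx.
Qed.

(** The symmetry of the third derivatives of [psi] makes the dual connection
    torsion-free. *)
Lemma hessian_dually_flat (R : realType) (T : Type) n (M : Defs.space R T n)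
    (psi : 'rV[R]_n -> R) :
  set_bij [set: 'rV[R]_n] (carrier M) (param M) -> smooth_on setT psi ->
  (forall t i j, metric M t i j = partial i (partial j psi) t) ->
  (forall t v, v != 0 -> 0 < dot (metric M t) v v) ->
  christoffel M = (fun _ _ _ _ => 0) ->
  dually_flat M.
Proof.
move=> bij spsi hess pos G0.
have hessE i j : (fun t => metric M t i j) = partial i (partial j psi).
  by apply/funext => t.
have sh : smooth_mx (metric M).
  by move=> i j; rewrite hessE; do 2!apply: smooth_partial.
have hT t : (metric M t)^T = metric M t.
  by apply/matrixP => i j; rewrite mxE !hess partialC.
have rh : riemannian (metric M) by [].
have uh t := riemannian_unitmx t rh.
have s1 : @smooth_mx R n n n (fun=> 1%:M).
  by move=> i j; exact: smooth_cst.
split; rewrite ?G0.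
- exact: bij.
- exact: rh.
- rewrite -(frame_connection_cst 1%:M).
  by apply: smooth_frame_connection => // t; exact: unitmx1.
- rewrite -(frame_connection_cst 1%:M).
  by apply: flat_frame_connection => // [t|t i j k];
    [exact: unitmx1|rewrite !partial_cst].
exists (frame_connection (metric M)); split.
- exact: smooth_frame_connection.
- exact: dual_frame_connection.
- apply: flat_frame_connection => // t i j k.
  by rewrite !hessE (partialC i j t (smooth_partial k spsi)).
Qed.

(** * Exponential families *)

Section ExponentialFamily.
Variables (R : realType) (Omega : finType) (n : nat).
Variables (C : Omega -> R) (F : Omega -> 'rV[R]_n) (psi : 'rV[R]_n -> R).
Hypothesis hprob : forall t : 'rV[R]_n, \sum_w expfam C F psi t w = 1.
Implicit Types (t u v : 'rV[R]_n) (i j : 'I_n) (w : Omega).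

Let p := expfam C F psi.

Lemma expfam_gt0 t w : 0 < p t w.
Proof. exact: expR_gt0. Qed.

(** Normalization determines [psi]; in particular its smoothness is a
    consequence. *)
Lemma expR_log_partition t :
  expR (psi t) = \sum_w expR (C w + \sum_i F w ord0 i * t ord0 i).
Proof.
rewrite -[LHS]mul1r -(hprob t) mulr_suml; apply: eq_bigr => w _.
by rewrite /expfam -expRD subrK.
Qed.

Lemma smooth_log_weight w :
  smooth_on setT (fun t : 'rV[R]_n => C w + \sum_i F w ord0 i * t ord0 i).
Proof.
apply: smoothD; first exact: smooth_cst.
apply: smooth_sum => i.
by apply: smoothM; [exact: smooth_cst|exact: smooth_coord].
Qed.

Lemma smooth_log_partition : smooth_on setT psi.
Proof.
have -> : psi = fun t => ln (\sum_w expR (C w + \sum_i F w ord0 i * t ord0 i)).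
  by apply/funext => t; rewrite -expR_log_partition expRK.
apply: smooth_ln => [|t]; last by rewrite -expR_log_partition expR_gt0.
by apply: smooth_sum => w; apply: smooth_expR; exact: smooth_log_weight.
Qed.

Lemma ln_expfam w :
  (fun t => ln (p t w)) = fun t => C w + \sum_i F w ord0 i * t ord0 i - psi t.
Proof. by apply/funext => t; rewrite expRK. Qed.

Lemma smooth_expfam w : smooth_on setT (fun t => p t w).
Proof.
apply: smooth_expR; apply: smoothB; [exact: smooth_log_weight|].
exact: smooth_log_partition.
Qed.

Lemma scoreE i w : score p i w = fun t => F w ord0 i - partial i psi t.
Proof.
apply/funext => t; rewrite /score ln_expfam partialB; last first.
- exact: smooth_log_partition.
- exact: smooth_log_weight.
congr (_ - _); rewrite partialD; last first.
- by apply: smooth_sum => j; apply: smoothM; [exact: smooth_cst|exact: smooth_coord].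
- exact: smooth_cst.
rewrite partial_cst add0r partial_sum => [|j]; last first.
  by apply: smoothM; [exact: smooth_cst|exact: smooth_coord].
have partial_term j := partialM i t (smooth_cst (F w ord0 j)) (smooth_coord j).
rewrite (bigD1 i)//= big1 ?addr0 => [|j ji]; rewrite partial_term.
- by rewrite partial_cst partial_coord eqxx mul0r addr0 mulr1.
- by rewrite partial_cst partial_coord eq_sym (negbTE ji) mulr0 mul0r addr0.
Qed.

Lemma partial_score i j w t :
  partial i (score p j w) t = - partial i (partial j psi) t.
Proof.
rewrite scoreE partialB; [by rewrite partial_cst sub0r|exact: smooth_cst|].
exact/smooth_partial/smooth_log_partition.
Qed.

Lemma smooth_score i w : smooth_on setT (score p i w).
Proof.
rewrite scoreE; apply: smoothB; first exact: smooth_cst.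
exact/smooth_partial/smooth_log_partition.
Qed.

Lemma partial_expfam i w t : partial i (fun t => p t w) t = p t w * score p i w t.
Proof.
rewrite /score ln_expfam partial_expR//; apply: smoothB.
  exact: smooth_log_weight.
exact: smooth_log_partition.
Qed.

(** Differentiate the identity [\sum_w p t w = 1]. *)
Lemma mean_score i t : \sum_w p t w * score p i w t = 0.
Proof.
transitivity (partial i (fun t => \sum_w p t w) t).
  rewrite partial_sum => [|w]; last exact: smooth_expfam.
  by apply: eq_bigr => w _; rewrite partial_expfam.
by under eq_fun do rewrite hprob; rewrite partial_cst.
Qed.

(** Differentiate the identity [mean_score]: the derivative of the density gives
    the Fisher metric, and that of the score gives minus the Hessian of [psi]. *)
Lemma fisher_hessian t i j : fisher p t i j = partial i (partial j psi) t.
Proof.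
have sp w : smooth_on setT (fun s => p s w * score p j w s).
  by apply: smoothM; [exact: smooth_expfam|exact: smooth_score].
have : partial i (fun s => \sum_w p s w * score p j w s) t = 0.
  by under eq_fun do rewrite mean_score; rewrite partial_cst.
rewrite partial_sum// mxE => D.
apply/eqP; rewrite -subr_eq0 -[X in _ == X]D; apply/eqP.
rewrite -[X in _ - X]mul1r -(hprob t) mulr_suml -sumrB.
apply: eq_bigr => w _; rewrite partialM; last first.
- exact: smooth_score.
- exact: smooth_expfam.
by rewrite partial_score partial_expfam mulrN addrC -mulrA.
Qed.

(** The derivative of a score does not depend on [w] ([partial_score]), so it
    factors out of a sum that is the mean of a score. *)
Lemma econn_expfam : econn p = fun _ _ _ _ => 0.
Proof.
apply/funext => t; apply/funext => i; apply/funext => j; apply/funext => k.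
apply: big1 => l _; rewrite (_ : econn_lower _ _ _ _ _ = 0) ?mul0r//.
rewrite /econn_lower; under eq_bigr do rewrite partial_score mulrCA.
by rewrite -mulr_sumr mean_score mulr0.
Qed.

Definition dscore t v w : R := \sum_i v ord0 i * score p i w t.

Lemma dot_fisher t u v :
  dot (fisher p t) u v = \sum_w p t w * (dscore t u w * dscore t v w).
Proof.
rewrite /dot !mxE.
have regroup (a b c d e : R) : a * (b * (c * d)) * e = b * (a * c) * (e * d).
  by ring.
transitivity (\sum_j \sum_i \sum_w
    p t w * (u ord0 i * score p i w t) * (v ord0 j * score p j w t)).
  apply: eq_bigr => j _; rewrite !mxE mulr_suml; apply: eq_bigr => i _.
  rewrite !mxE mulr_sumr mulr_suml; apply: eq_bigr => w _.
  exact: regroup.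
under eq_bigr do rewrite exchange_big.
rewrite exchange_big; apply: eq_bigr => w _ /=.
rewrite /dscore exchange_big big_distrlr/= mulr_sumr; apply: eq_bigr => i _.
rewrite mulr_sumr; apply: eq_bigr => j _; exact/esym/mulrA.
Qed.

Lemma dscoreE t v : exists c, forall w,
  dscore t v w = \sum_i F w ord0 i * v ord0 i - c.
Proof.
exists (\sum_i v ord0 i * partial i psi t) => w; rewrite -sumrB.
by apply: eq_bigr => i _; rewrite scoreE mulrBr [F _ _ _ * _]mulrC.
Qed.

Lemma mean_dscore t v : \sum_w p t w * dscore t v w = 0.
Proof.
under eq_bigr do rewrite mulr_sumr.
rewrite exchange_big big1// => i _ /=.
by under eq_bigr do rewrite mulrCA; rewrite -mulr_sumr mean_score mulr0.
Qed.

(** Linear independence of 1, F_1, ..., F_n in the form in which it is used. *)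
Definition minimal_statistic := forall v (c : R),
  (forall w, \sum_i F w ord0 i * v ord0 i = c) -> v = 0.
Hypothesis Fmin : minimal_statistic.

Lemma fisher_posdef t v : v != 0 -> 0 < dot (fisher p t) v v.
Proof.
move=> v0; rewrite dot_fisher.
have ge0 w : 0 <= p t w * (dscore t v w * dscore t v w).
  by apply: mulr_ge0; [exact/ltW/expfam_gt0|rewrite -expr2 sqr_ge0].
rewrite lt_neqAle sumr_ge0// andbT eq_sym; apply: contra v0.
rewrite psumr_eq0// => /allP s0.
have [c cE] := dscoreE t v.
apply/eqP/(Fmin (c := c)) => w.
have /implyP/(_ isT) := s0 w (mem_index_enum w).
rewrite mulf_eq0 gt_eqF ?expfam_gt0//= mulf_eq0 orbb cE subr_eq0.
by move=> /eqP.
Qed.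

(** Equal densities have equal logarithms, so [<F, s - t>] is the constant
    [psi s - psi t]. *)
Lemma expfam_inj : injective p.
Proof.
move=> s t st; apply/eqP; rewrite -subr_eq0; apply/eqP.
apply: (Fmin (c := psi s - psi t)) => w.
have := congr1 (fun q => ln (q w)) st; rewrite !expRK => E.
under eq_bigr do rewrite !mxE mulrBr.
by rewrite sumrB; lra.
Qed.

Lemma expfam_dually_flat (E : set (Omega -> R)) : range p = E ->
  dually_flat (stat_space p E).
Proof.
move=> pE; apply: (hessian_dually_flat (psi := psi)).
- split=> /=; first by move=> t _; rewrite -pE; exists t.
  + by move=> s t _ _; exact: expfam_inj.
  + by rewrite -pE.
- exact: smooth_log_partition.
- exact: fisher_hessian.
- exact: fisher_posdef.
- exact: econn_expfam.
Qed.

End ExponentialFamily.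

(** A relation [c = <F, v>] is a linear relation among the listed functions, with
    coefficients [- c] and the entries of [v]. *)
Lemma free_minimal_statistic (R : realType) n (Omega : finType)
    (F : Omega -> 'rV[R]_n) :
  free ([ffun=> 1 : R^o] ::
        [seq [ffun w => F w ord0 i : R^o] | i <- enum 'I_n]) ->
  minimal_statistic F.
Proof.
set X := _ :: _ => /(@freeP _ _ _ (in_tuple X)) freeX v c vc.
pose K : seq R := - c :: [seq v ord0 i | i <- enum 'I_n].
have sKX : size K = size X by rewrite /= !size_map.
have sum0 : \sum_(i < size X) K`_i *: X`_i = 0.
  transitivity (\sum_(a <- zip K X) a.1 *: a.2).
    rewrite (big_nth (0, 0)) big_mkord size2_zip ?sKX//.
    by apply: eq_bigr => i _; rewrite nth_zip.
  rewrite /K /X /= zip_map big_cons big_map big_enum /=; apply/ffunP => w.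
  rewrite !ffunE sum_ffunE; apply/eqP; rewrite [_ *: _]mulr1 addrC subr_eq0 -(vc w).
  apply/eqP; apply: eq_bigr => i _; rewrite !ffunE.
  exact: mulrC.
have K0 := freeX (fun i => K`_i) sum0.
apply/rowP => i; rewrite mxE.
have iX : (i.+1 < size X)%N by rewrite -sKX /= size_map size_enum_ord ltnS.
have := K0 (Ordinal iX); rewrite /= (nth_map i) ?size_enum_ord// nth_ord_enum.
by [].
Qed.

(** * Global affine coordinates and affine maps *)

Definition global_coords (R : realType) n : local_coords R n :=
  LocalCoords setT setT id id.

(** Where the Christoffel symbols vanish, the given coordinates are affine. *)
Lemma affine_global_coords (R : realType) n :
  affine_coords (fun _ _ _ _ => 0) (global_coords R n).
Proof.
split.
  split=> //.
  - by split; exact: openT.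
  - by split=> k; exact: smooth_coord.
move=> i j t _; apply/rowP => k; rewrite !mxE.
have -> : (fun s => coord_vfield (global_coords R n) j s ord0 k) = fun=> (j == k)%:R.
  by apply/funext => s; rewrite mxE partial_coord.
rewrite /vderiv !big1 ?addr0// => l _; last by rewrite partial_cst mulr0.
by apply: big1 => m _; rewrite !mul0r.
Qed.

Lemma diff_affine (R : realType) n m (A : 'M[R]_(n, m)) (B : 'rV[R]_m)
    (t : 'rV[R]_n) :
  'd (fun u : 'rV[R]_n => u *m A + B) t = mulmxr A :> ('rV[R]_n -> 'rV[R]_m).
Proof.
have sumE : (fun u : 'rV[R]_n => u *m A) =
    \sum_i (fun u : 'rV[R]_n => u ord0 i *: row i A).
  by apply/funext => s; rewrite fct_sumE /= mulmx_sum_row.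
have cA : continuous (mulmxr A : 'rV[R]_n -> 'rV[R]_m).
  suff : continuous (fun u : 'rV[R]_n => u *m A) by [].
  move=> u; rewrite sumE; apply: differentiable_continuous.
  apply: differentiable_sum => i; apply: differentiableZl.
  exact: differentiable_coord.
have isA : is_diff t (mulmxr A : 'rV[R]_n -> 'rV[R]_m) (mulmxr A).
  by split; [exact: linear_differentiable|exact: diff_lin].
have [_ dE] := is_diffD isA (is_diff_cst B t).
by rewrite -[RHS]addr0 -dE.
Qed.

(** * The simplex *)

Section Simplex.
Variables (R : realType) (Omega : finType) (r : nat) (x : 'I_r.+1 -> Omega).
Hypothesis hx : bijective x.
Implicit Types (q : Omega -> R) (t v : 'rV[R]_r).

Let xk (k : 'I_r) : Omega := x (widen_ord (leqnSn r) k).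
Let x_inj : injective x := bij_inj hx.

(** Case analysis on Omega matching the two clauses that define the natural
    parameters of the simplex. *)
Lemma vertex_ind (P : Omega -> Prop) :
  (forall k, P (xk k)) -> P (x ord_max) -> forall w, P w.
Proof.
move=> Pk Pr w; have [y xK yK] := hx; rewrite -(yK w).
case: (unliftP ord_max (y w)) => [k ->|-> //].
rewrite (_ : lift _ _ = widen_ord (leqnSn r) k); first exact: Pk.
by apply: val_inj; exact: lift_max.
Qed.

Lemma sum_vertex (f : Omega -> R) :
  \sum_w f w = \sum_k f (xk k) + f (x ord_max).
Proof. by rewrite (reindex x) ?big_ord_recr //; exact: onW_bij. Qed.

Lemma simplex_statistic v k :
  \sum_l simplex_F R x (xk k) ord0 l * v ord0 l = v ord0 k.
Proof.
rewrite (bigD1 k)//= mxE eqxx mul1r big1 ?addr0// => l lk.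
rewrite mxE (inj_eq x_inj) -val_eqE /= eq_sym (val_eqE l k).
by rewrite (negbTE lk) mul0r.
Qed.

Lemma simplex_statistic_max v :
  \sum_l simplex_F R x (x ord_max) ord0 l * v ord0 l = 0.
Proof.
apply: big1 => l _.
by rewrite mxE (inj_eq x_inj) -val_eqE /= gtn_eqF ?mul0r.
Qed.

Lemma simplex_minimal : minimal_statistic (simplex_F R x).
Proof.
move=> v c vc; have c0 : c = 0 by rewrite -(vc (x ord_max)) simplex_statistic_max.
by apply/rowP => k; rewrite -simplex_statistic vc c0 mxE.
Qed.

Lemma simplex_param_sum t : \sum_w simplex_param x t w = 1.
Proof.
rewrite sum_vertex simplex_param_last//.
under eq_bigr do rewrite simplex_param_widen// expRD.
have Z0 : 0 < 1 + \sum_k expR (t ord0 k).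
  by rewrite ltr_pwDl ?sumr_ge0// => k _; exact: expR_ge0.
rewrite -mulr_suml -[X in _ + X]mul1r -mulrDl expRN /simplex_psi.
by rewrite [X in X * _]addrC lnK ?posrE// mulfV ?gt_eqF.
Qed.

Definition log_odds q : 'rV[R]_r := \row_k (ln (q (xk k)) - ln (q (x ord_max))).

(** Surjectivity of the parametrization: [1 + \sum_k q (x_k) / q (x_r)] is
    [(q (x_r))^-1], so the normalizing function at the log odds is
    [- ln (q (x_r))]. *)
Lemma log_oddsK q : pos_prob q -> simplex_param x (log_odds q) = q.
Proof.
move=> [q0 q1].
have psiE : simplex_psi (log_odds q) = - ln (q (x ord_max)).
  rewrite -lnV ?posrE//; congr ln; apply: (mulIf (lt0r_neq0 (q0 (x ord_max)))).
  rewrite mulrDl mul1r mulVf ?gt_eqF// -[RHS]q1 sum_vertex addrC mulr_suml.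
  congr (_ + _); apply: eq_bigr => k _.
  by rewrite mxE -lnV ?posrE// expRD !lnK ?posrE ?invr_gt0// mulfVK ?gt_eqF.
apply/funext; apply: vertex_ind => [k|].
  by rewrite simplex_param_widen// psiE mxE opprK subrK lnK ?posrE.
by rewrite simplex_param_last// psiE opprK lnK ?posrE.
Qed.

Lemma range_simplex_param : range (simplex_param x) = @pos_prob R Omega.
Proof.
apply/seteqP; split=> [q [t _ <-]|q qP].
  by split=> [w|]; [exact: expfam_gt0|exact: simplex_param_sum].
by exists (log_odds q) => //; exact: log_oddsK.
Qed.

Lemma simplex_dually_flat : dually_flat (simplex_space R x).
Proof.
apply: expfam_dually_flat.
- exact: simplex_param_sum.
- exact: simplex_minimal.
- exact: range_simplex_param.
Qed.

Lemma chart_simplex q : pos_prob q -> chart (simplex_space R x) q = log_odds q.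
Proof.
move=> qP; rewrite /chart /=; case: xgetP => [t _ /= tq|/(_ (log_odds q))].
  apply: (@expfam_inj _ _ _ (fun=> 0) _ (@simplex_psi R r) simplex_minimal).
  by apply: etrans tq _; rewrite -/(simplex_param x _) log_oddsK.
by case; exact: log_oddsK.
Qed.

End Simplex.

(** * The inclusion of an exponential family in the simplex *)

Section Inclusion.
Variables (R : realType) (r n : nat) (Omega : finType) (x : 'I_r.+1 -> Omega).
Hypothesis hx : bijective x.
Variables (C : Omega -> R) (F : Omega -> 'rV[R]_n) (psi : 'rV[R]_n -> R).
Hypothesis hprob : forall t : 'rV[R]_n, \sum_w expfam C F psi t w = 1.
Implicit Types (t v : 'rV[R]_n) (k : 'I_r).

Let p := expfam C F psi.
Let xk (k : 'I_r) : Omega := x (widen_ord (leqnSn r) k).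

Definition contrast_mx : 'M[R]_(n, r) :=
  \matrix_(i, k) (F (xk k) ord0 i - F (x ord_max) ord0 i).

Definition contrast_row : 'rV[R]_r := \row_k (C (xk k) - C (x ord_max)).

Lemma mulmx_contrast v k : (v *m contrast_mx) ord0 k =
  \sum_i F (xk k) ord0 i * v ord0 i - \sum_i F (x ord_max) ord0 i * v ord0 i.
Proof.
rewrite !mxE -sumrB; apply: eq_bigr => i _.
by rewrite mxE mulrC mulrBl.
Qed.

Lemma pos_prob_expfam t : pos_prob (p t).
Proof. by split=> [w|]; [exact: expfam_gt0|exact: hprob]. Qed.

(** Taking the difference of two log densities cancels [psi], the only term that
    is not affine in [t]. *)
Lemma log_odds_expfam t : log_odds x (p t) = t *m contrast_mx + contrast_row.
Proof.
apply/rowP => k.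
rewrite mxE [RHS]mxE mulmx_contrast [contrast_row _ _]mxE /p /expfam !expRK.
rewrite -/(xk k); ring.
Qed.

Lemma local_rep_inclusion :
  local_rep (expfam_space C F psi) (simplex_space R x) (fun q => q) =
  fun t => t *m contrast_mx + contrast_row.
Proof.
apply/funext => t; rewrite -log_odds_expfam.
by apply: chart_simplex => //; exact: pos_prob_expfam.
Qed.

Lemma simplex_param_inclusion t :
  simplex_param x (t *m contrast_mx + contrast_row) = p t.
Proof. by rewrite -log_odds_expfam log_oddsK//; exact: pos_prob_expfam. Qed.

(** On both sides the directional score is a statistic minus its mean, and the two
    statistics differ by the constant [b]. The two scores thus differ by a
    constant [d], which is zero since both have mean zero for the same density. *)
Lemma dscore_inclusion t v w :
  dscore (fun=> 0) (simplex_F R x) (@simplex_psi R r)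
    (t *m contrast_mx + contrast_row) (v *m contrast_mx) w = dscore C F psi t v w.
Proof.
set t' := t *m _ + _; set v' := v *m _.
have [c cE] := dscoreE hprob t v.
have [c' cE'] := dscoreE (simplex_param_sum hx) t' v'.
pose b := \sum_i F (x ord_max) ord0 i * v ord0 i.
pose d := c - b - c'.
have {cE'}gap w' : dscore (fun=> 0) (simplex_F R x) (@simplex_psi R r) t' v' w'
    = dscore C F psi t v w' + d.
  rewrite cE' cE /d.
  have -> : \sum_i simplex_F R x w' ord0 i * v' ord0 i
      = \sum_i F w' ord0 i * v ord0 i - b; last by lra.
  elim/(vertex_ind hx): w' => [k|].
    by rewrite simplex_statistic// mulmx_contrast.
  by rewrite simplex_statistic_max// subrr.
suff d0 : d = 0 by rewrite gap d0 addr0.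
have := mean_dscore (simplex_param_sum hx) t' v'.
rewrite -/(simplex_param x) simplex_param_inclusion.
under eq_bigr do rewrite gap mulrDr.
by rewrite big_split /= mean_dscore// -mulr_suml hprob add0r mul1r.
Qed.

End Inclusion.

Theorem lemma11p1 (R : realType) (r n : nat) (Omega : finType)
    (x : 'I_r.+1 -> Omega) (hx : bijective x)
    (C : Omega -> R) (F : Omega -> 'rV[R]_n) (psi : 'rV[R]_n -> R)
    (hprob : forall t : 'rV[R]_n, \sum_w expfam C F psi t w = 1)
    (hfree : free ([ffun=> 1 : R^o] ::
                   [seq [ffun w => F w ord0 i : R^o] | i <- enum 'I_n])) :
  affine_isometric_immersion (expfam_space C F psi) (simplex_space R x)
    (fun p : Omega -> R => p).
Proof.
have Fmin := free_minimal_statistic hfree.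
have repE := local_rep_inclusion hx hprob.
set A := contrast_mx x F in repE; set B := contrast_row x C in repE.
have smooth_inclusion :
    smooth_map (expfam_space C F psi) (simplex_space R x) (fun q => q).
  split; first by move=> _ [t _ <-]; exact: pos_prob_expfam.
  rewrite repE => k; under eq_fun do rewrite !mxE.
  apply: smoothD; last exact: smooth_cst.
  apply: smooth_sum => i.
  by apply: smoothM; [exact: smooth_coord|exact: smooth_cst].
split.
- split.
  + exact: expfam_dually_flat.
  + exact: simplex_dually_flat.
  + exact: smooth_inclusion.
  move=> q _; exists (global_coords R n), (global_coords R r), A, B; split=> /=.
  + split=> //; rewrite econn_expfam//; exact: affine_global_coords.
  + split=> //; rewrite econn_expfam; first exact: affine_global_coords.
    exact: simplex_param_sum.
  + by move=> t _; rewrite repE.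
- move=> t u v; rewrite repE !diff_affine /=.
  rewrite !dot_fisher -/(simplex_param x) (simplex_param_inclusion hx hprob).
  by apply: eq_bigr => w _; rewrite !(dscore_inclusion hx hprob).
- split=> [|t u v]; first exact: smooth_inclusion.
  rewrite repE diff_affine /= => uvA.
  apply/eqP; rewrite -subr_eq0; apply/eqP.
  have dA0 : (u - v) *m A = 0 by rewrite mulmxBl uvA subrr.
  apply: (Fmin _ (\sum_i F (x ord_max) ord0 i * (u - v) ord0 i)).
  apply: (vertex_ind hx) => // k.
  apply/eqP; rewrite -subr_eq0; apply/eqP.
  by apply: etrans (esym (mulmx_contrast x F (u - v) k)) _; rewrite dA0 mxE.
Qed.
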